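(* Consider a $3\times 4$ discrete conjugate net in $\mathbb{R}^3$ with vertices $p_{i,j}$, $0\le i\le 3$, $0\le j\le 4$, where $$p_{1,1}=(0,0,0),\quad p_{1,2}=(0,0,-1),\quad p_{1,3}=(0,1,-1),$$ $$p_{2,1}=(1,0,0),\quad p_{2,2}=(1,0,-1),\quad p_{2,3}=(1,1,-1),$$ $$p_{1,0}=p_{1,1}-(1,1,-1),\quad p_{2,0}=p_{2,1}-(1,1,-1),\quad p_{1,4}=p_{1,3}+(-1,1,-1),\quad p_{2,4}=p_{2,3}+(1,1,-1),$$ $$p_{0,j}=p_{1,j}-(0,-1,-1),\qquad p_{3,j}=p_{2,j}+(0,1,1)\qquad (j=1,2,3),$$ and the four corner vertices $p_{0,0},p_{0,4},p_{3,0},p_{3,4}$ are chosen so that the four corner faces are planar strictly convex quadrilaterals. Then both of its $3\times 3$-subnets (the one with face columns $1,2,3$ and the one with face columns $2,3,4$) are infinitesimally flexible, while the net as a whole is infinitesimally rigid.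
   Context: An $m\times n$ discrete conjugate net is a polyhedral surface in $\mathbb{R}^3$ with planar quadrilateral faces connected in the combinatorics of an $m\times n$ square grid of faces: points $p_{i,j}\in\mathbb{R}^3$, $0\le i\le m$, $0\le j\le n$, such that for $1\le i\le m$, $1\le j\le n$ the points $p_{i-1,j-1},p_{i-1,j},p_{i,j},p_{i,j-1}$ are, in this cyclic order, the vertices of a planar quadrilateral (the face $F_{i,j}$ in row $i$ and column $j$). An infinitesimal isometry of $\mathbb{R}^3$ is a vector field of the form $\xi(x)=r\times x+b$ with $r,b\in\mathbb{R}^3$. An infinitesimal isometric deformation of a polyhedral surface is an assignment of an infinitesimal isometry $\xi_F$ to every face $F$ such that for any two faces sharing an edge the restrictions of the two vector fields to the common edge agree. It is trivial if all $\xi_F$ are equal. A polyhedral surface is infinitesimally flexible if it admits a non-trivial infinitesimal isometric deformation, and infinitesimally rigid otherwise. *)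

(* Defs.v *)
From mathcomp Require Import all_boot all_order all_algebra.
From mathcomp Require Import reals.

Set Implicit Arguments.
Unset Strict Implicit.
Unset Printing Implicit Defensive.

Import Order.TTheory GRing.Theory Num.Theory.
Local Open Scope ring_scope.

Definition vec3 (R : realType) (a b c : R) : 'rV[R]_3 :=
  \row_(k < 3) [:: a; b; c]`_k.

Definition dot (R : realType) (u v : 'rV[R]_3) : R :=
  \sum_(k < 3) u 0 k * v 0 k.

(* The column indices are elements of the ring 'I_3. *)
Definition cross (R : realType) (u v : 'rV[R]_3) : 'rV[R]_3 :=
  vec3 (u 0 1 * v 0 2%:R - u 0 2%:R * v 0 1)
       (u 0 2%:R * v 0 0 - u 0 0 * v 0 2%:R)
       (u 0 0 * v 0 1 - u 0 1 * v 0 0).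

Definition on_segment (R : realType) (a b x : 'rV[R]_3) : Prop :=
  exists t : R, 0 <= t <= 1 /\ x = (1 - t) *: a + t *: b.

Definition coplanar4 (R : realType) (a b c d : 'rV[R]_3) : Prop :=
  exists n : 'rV[R]_3,
    [/\ n != 0, dot n (b - a) = 0, dot n (c - a) = 0 & dot n (d - a) = 0].

(* Four points spanning, in this cyclic order, a possibly non-convex planar
   quadrilateral: they are coplanar, no angle is 0 or straight, and opposite
   sides are disjoint, so that the boundary is a simple closed polygon. *)
Definition planar_quad (R : realType) (a b c d : 'rV[R]_3) : Prop :=
  [/\ coplanar4 a b c d,
      [/\ cross (b - a) (c - b) != 0, cross (c - b) (d - c) != 0,
          cross (d - c) (a - d) != 0 & cross (a - d) (b - a) != 0],
      ~ (exists x, on_segment a b x /\ on_segment c d x)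
    & ~ (exists x, on_segment b c x /\ on_segment d a x)].

(* Within a plane with normal n, the point x lies strictly to the left of the
   line from v to w. *)
Definition left_of (R : realType) (n v w x : 'rV[R]_3) : Prop :=
  0 < dot n (cross (w - v) (x - v)).

(* The quadrilateral abcd is planar, and each side has the other two vertices
   strictly on its inner side; n orients the plane so that abcd is
   counterclockwise. *)
Definition strictly_convex_planar_quad (R : realType)
    (a b c d : 'rV[R]_3) : Prop :=
  exists n : 'rV[R]_3,
    [/\ dot n (b - a) = 0, dot n (c - a) = 0 & dot n (d - a) = 0] /\
    [/\ left_of n a b c /\ left_of n a b d,
        left_of n b c d /\ left_of n b c a,
        left_of n c d a /\ left_of n c d b
      & left_of n d a b /\ left_of n d a c].

(* The vertices of an m x n net form a map p : nat -> nat -> 'rV[R]_3 of which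
   only the values p i j with i <= m and j <= n are relevant; the faces are
   indexed from 1. *)
Definition is_face (m n i j : nat) : bool := (1 <= i <= m)%N && (1 <= j <= n)%N.

Definition face_verts (i j : nat) : seq (nat * nat) :=
  [:: (i.-1, j.-1); (i.-1, j); (i, j); (i, j.-1)].

Definition on_face (R : realType)
    (P : 'rV[R]_3 -> 'rV[R]_3 -> 'rV[R]_3 -> 'rV[R]_3 -> Prop)
    (p : nat -> nat -> 'rV[R]_3) (i j : nat) : Prop :=
  P (p i.-1 j.-1) (p i.-1 j) (p i j) (p i j.-1).

Definition conjugate_net (R : realType) (m n : nat)
    (p : nat -> nat -> 'rV[R]_3) : Prop :=
  forall i j, is_face m n i j -> on_face (@planar_quad R) p i j.

(* The subnet whose first face is the face in row a + 1 and column b + 1. *)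
Definition subnet (R : realType) (a b : nat) (p : nat -> nat -> 'rV[R]_3)
  : nat -> nat -> 'rV[R]_3 := fun i j => p (a + i)%N (b + j)%N.

(* The vertices (with indices) v and w are the ends of an edge of the face. *)
Definition face_edge (i j : nat) (v w : nat * nat) : bool :=
  (v \in face_verts i j) &&
  ((w == next (face_verts i j) v) || (w == prev (face_verts i j) v)).

Definition infinitesimal_isometry (R : realType)
    (xi : 'rV[R]_3 -> 'rV[R]_3) : Prop :=
  exists r b : 'rV[R]_3, forall x, xi x = cross r x + b.

Definition infinitesimal_isometric_deformation (R : realType) (m n : nat)
    (p : nat -> nat -> 'rV[R]_3)
    (xi : nat -> nat -> 'rV[R]_3 -> 'rV[R]_3) : Prop :=
  (forall i j, is_face m n i j -> infinitesimal_isometry (xi i j)) /\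
  (forall i j i' j' v w, is_face m n i j -> is_face m n i' j' ->
     face_edge i j v w -> face_edge i' j' v w ->
     forall x, on_segment (p v.1 v.2) (p w.1 w.2) x -> xi i j x = xi i' j' x).

Definition trivial_deformation (R : realType) (m n : nat)
    (xi : nat -> nat -> 'rV[R]_3 -> 'rV[R]_3) : Prop :=
  forall i j i' j', is_face m n i j -> is_face m n i' j' ->
    xi i j =1 xi i' j'.

Definition infinitesimally_flexible (R : realType) (m n : nat)
    (p : nat -> nat -> 'rV[R]_3) : Prop :=
  exists xi, infinitesimal_isometric_deformation m n p xi /\
             ~ trivial_deformation m n xi.

Definition infinitesimally_rigid (R : realType) (m n : nat)
    (p : nat -> nat -> 'rV[R]_3) : Prop :=
  ~ infinitesimally_flexible m n p.

(* Main.v *)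
(* The rotation vectors of two faces sharing an edge differ by a multiple of
   that edge, and around each interior vertex these differences sum to zero.
   At every interior vertex of this net the four edges span space, so the four
   coefficients are determined up to one scalar.  Comparing the coefficients
   along the shared edges leaves a one-parameter family for either 3 x 3
   subnet, whereas for the 3 x 4 net going once around the six interior
   vertices forces a sign change, hence all coefficients vanish. *)
Require Import Defs.
From mathcomp Require Import all_boot all_order all_algebra.
From mathcomp Require Import reals boolp.
From mathcomp Require Import ring lra.

Import Order.TTheory GRing.Theory Num.Theory.
Local Open Scope ring_scope.

(** * Coordinates and the cross product *)

Lemma vec3E (R : realType) (a b c : R) :
  (vec3 a b c 0 0 = a) * (vec3 a b c 0 1 = b) * (vec3 a b c 0 2%:R = c).
Proof. by rewrite /vec3 !mxE. Qed.

Lemma row3P (R : realType) (u v : 'rV[R]_3) :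
  u = v <-> [/\ u 0 0 = v 0 0, u 0 1 = v 0 1 & u 0 2%:R = v 0 2%:R].
Proof.
split=> [-> //|[e0 e1 e2]]; apply/rowP => -[[|[|[|//]]] lt_k3].
- by rewrite (_ : Ordinal lt_k3 = 0) //; apply: val_inj.
- by rewrite (_ : Ordinal lt_k3 = 1) //; apply: val_inj.
- by rewrite (_ : Ordinal lt_k3 = 2%:R) //; apply: val_inj.
Qed.

Lemma crossBr (R : realType) (r x y : 'rV[R]_3) :
  cross r (x - y) = cross r x - cross r y.
Proof. by apply/row3P; rewrite /cross !(vec3E, mxE); split; ring. Qed.

Lemma crossBl (R : realType) (r s x : 'rV[R]_3) :
  cross (r - s) x = cross r x - cross s x.
Proof. by apply/row3P; rewrite /cross !(vec3E, mxE); split; ring. Qed.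

Lemma cross0l (R : realType) (x : 'rV[R]_3) : cross 0 x = 0.
Proof. by apply/row3P; rewrite /cross !(vec3E, mxE); split; ring. Qed.

Lemma cross_eq0_colinear (R : realType) (r d : 'rV[R]_3) :
  d != 0 -> cross r d = 0 -> exists w : R, r = w *: d.
Proof.
move=> d0 /row3P; rewrite !(vec3E, mxE) => -[e0 e1 e2].
have [/eqP dx|dx] := boolP (d 0 0 == 0); last first.
  by exists (r 0 0 / d 0 0); apply/row3P; split; rewrite !mxE;
    apply: (mulIf dx); rewrite mulrAC divfK //; lra.
have [/eqP dy|dy] := boolP (d 0 1 == 0); last first.
  by exists (r 0 1 / d 0 1); apply/row3P; split; rewrite !mxE;
    apply: (mulIf dy); rewrite mulrAC divfK //; lra.
have dz : d 0 2%:R != 0.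
  by apply: contraNneq d0 => dz; apply/eqP/row3P; rewrite !mxE.
by exists (r 0 2%:R / d 0 2%:R); apply/row3P; split; rewrite !mxE;
  apply: (mulIf dz); rewrite mulrAC divfK //; lra.
Qed.

(** * Building deformations and showing flexibility *)

Lemma infinitesimal_isometry_segment (R : realType)
    (xi : 'rV[R]_3 -> 'rV[R]_3) (a b : 'rV[R]_3) (t : R) :
  infinitesimal_isometry xi ->
  xi ((1 - t) *: a + t *: b) = (1 - t) *: xi a + t *: xi b.
Proof.
move=> [r [c xiE]]; rewrite !xiE.
by apply/row3P; rewrite /cross !(vec3E, mxE); split; ring.
Qed.

(** Infinitesimal isometries are affine, so agreement at the two ends of an edge gives agreement
    along it. *)
Lemma deformation_of_vertex_velocities (R : realType) (m n : nat)
    (p : nat -> nat -> 'rV[R]_3) (xi : nat -> nat -> 'rV[R]_3 -> 'rV[R]_3)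
    (u : nat * nat -> 'rV[R]_3) :
  (forall i j, is_face m n i j -> infinitesimal_isometry (xi i j)) ->
  (forall i j v, is_face m n i j -> v \in face_verts i j ->
     xi i j (p v.1 v.2) = u v) ->
  infinitesimal_isometric_deformation m n p xi.
Proof.
move=> isom xiu; split=> // i j i' j' v w F F' /andP[vF wF] /andP[vF' wF'].
have edge_end k l : v \in face_verts k l ->
    (w == next (face_verts k l) v) || (w == prev (face_verts k l) v) ->
  w \in face_verts k l.
  by move=> vkl /orP[] /eqP->; rewrite ?mem_next ?mem_prev.
move=> x [t [_ ->]]; rewrite !infinitesimal_isometry_segment; try exact: isom.
by rewrite !xiu //; apply: edge_end.
Qed.

(* The central face is held fixed and the face (i, j) rotates about the vertex
   of the central face nearest to it; the reference velocity of the vertex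
   (k, l) is read off from the incident face (max(1, k), max(1, l)). *)
Lemma flexible_3x3 (R : realType) (p r : nat -> nat -> 'rV[R]_3)
    (xi := fun i j x =>
       cross (r i j) (x - p (if (i <= 1)%N then 1%N else 2%N)
                            (if (j <= 1)%N then 1%N else 2%N))) :
  r 2%N 2%N = 0 -> r 1%N 1%N != 0 ->
  (forall i j v, is_face 3 3 i j -> v \in face_verts i j ->
     xi i j (p v.1 v.2) = xi (maxn 1 v.1) (maxn 1 v.2) (p v.1 v.2)) ->
  infinitesimally_flexible 3 3 p.
Proof.
move=> r22 r11 xiu; exists xi; split.
  pose u v := xi (maxn 1 v.1) (maxn 1 v.2) (p v.1 v.2).
  apply: (@deformation_of_vertex_velocities _ _ _ _ _ u) xiu => i j _.
  rewrite /xi; set q := p _ _.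
  by exists (r i j), (- cross (r i j) q) => x; rewrite crossBr.
move=> /(_ 1%N 1%N 2%N 2%N isT isT) triv; case/eqP: r11.
(* The field of face (1, 1) vanishes at its anchor [p 1 1], so equality with the zero field of the
   central face kills all its linear part. *)
have rot d : cross (r 1%N 1%N) d = 0.
  by rewrite -(addrK (p 1%N 1%N) d); move: (triv (d + p 1%N 1%N));
    rewrite /xi r22 cross0l.
move: (rot (vec3 1 0 0)) (rot (vec3 0 1 0)).
by do 2![move=> /row3P; rewrite !(vec3E, mxE) => -[? ? ?]];
  apply/row3P; rewrite !mxE; split; lra.
Qed.

(** * From a deformation to a stress on the interior edges *)

Lemma deformation_agree (R : realType) (m n : nat) (p : nat -> nat -> 'rV[R]_3)
    (xi : nat -> nat -> 'rV[R]_3 -> 'rV[R]_3) (i j i' j' : nat)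
    (v w : nat * nat) :
  infinitesimal_isometric_deformation m n p xi ->
  is_face m n i j -> is_face m n i' j' ->
  face_edge i j v w -> face_edge i' j' v w ->
  xi i j (p v.1 v.2) = xi i' j' (p v.1 v.2) /\
  xi i j (p w.1 w.2) = xi i' j' (p w.1 w.2).
Proof.
move=> [_ agree] F F' e e'; split; apply: (agree _ _ _ _ _ _ F F' e e').
  by exists 0; rewrite lexx ler01 subr0 scale1r scale0r addr0.
by exists 1; rewrite lexx ler01 subrr scale1r scale0r add0r.
Qed.

Lemma face_edge_sides (i j : nat) :
  [/\ face_edge i.+1 j.+1 (i, j) (i, j.+1),
      face_edge i.+1 j.+1 (i.+1, j) (i.+1, j.+1),
      face_edge i.+1 j.+1 (i, j) (i.+1, j)
    & face_edge i.+1 j.+1 (i, j.+1) (i.+1, j.+1)].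
Proof.
by rewrite /face_edge /= !inE !xpair_eqE !eqxx /=
  !(gtn_eqF (ltnSn _)) !(ltn_eqF (ltnSn _)) /= ?xpair_eqE ?eqxx ?orbT.
Qed.

Lemma planar_quad_sides (R : realType) (a b c d : 'rV[R]_3) :
  planar_quad a b c d -> [/\ b - a != 0, c - b != 0, d - c != 0 & a - d != 0].
Proof.
by move=> [_ [ab bc cd da] _ _]; split; [move: ab|move: bc|move: cd|move: da];
  apply: contraNneq => ->; rewrite cross0l.
Qed.

(** Subtracting the agreements at the two ends cancels the translations and leaves
    [cross (r' - r) (b - a) = 0]. *)
Lemma rotation_jump (R : realType) (xi xi' : 'rV[R]_3 -> 'rV[R]_3)
    (r r' c c' a b : 'rV[R]_3) :
  (forall x, xi x = cross r x + c) -> (forall x, xi' x = cross r' x + c') ->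
  b - a != 0 -> xi a = xi' a -> xi b = xi' b ->
  exists w : R, r' - r = w *: (b - a).
Proof.
move=> xiE xi'E ab xia xib; apply: cross_eq0_colinear => //.
rewrite crossBr !crossBl; move: xia xib; rewrite !xiE !xi'E => ea eb.
have -> : cross r' a = cross r a + c - c' by rewrite ea addrK.
have -> : cross r' b = cross r b + c - c' by rewrite eb addrK.
by apply/row3P; rewrite !mxE; split; ring.
Qed.

Lemma isometry_eq_of_rotation (R : realType) (xi xi' : 'rV[R]_3 -> 'rV[R]_3)
    (r c c' a : 'rV[R]_3) :
  (forall x, xi x = cross r x + c) -> (forall x, xi' x = cross r x + c') ->
  xi a = xi' a -> xi =1 xi'.
Proof. by move=> xiE xi'E; rewrite xiE xi'E => /addrI e x; rewrite xiE xi'E e. Qed.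

(* Across an edge the rotation vector jumps by a multiple of the edge vector,
   and the jumps around an interior vertex cancel.  H i j is the multiple for
   the edge from (i, j) to (i, j + 1), and V i j for that from (i, j) to
   (i + 1, j). *)
Lemma deformation_stress (R : realType) (m n : nat)
    (p : nat -> nat -> 'rV[R]_3) (xi : nat -> nat -> 'rV[R]_3 -> 'rV[R]_3) :
  conjugate_net m n p -> infinitesimal_isometric_deformation m n p xi ->
  exists H V : nat -> nat -> R,
    (forall i j, (i.+1 < m)%N -> (j.+1 < n)%N ->
       H i.+1 j.+1 *: (p i.+1 j.+2 - p i.+1 j.+1) +
       H i.+1 j *: (p i.+1 j - p i.+1 j.+1) +
       V i.+1 j.+1 *: (p i.+2 j.+1 - p i.+1 j.+1) +
       V i j.+1 *: (p i j.+1 - p i.+1 j.+1) = 0) /\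
    ((forall i j, (i.+1 < m)%N -> (j < n)%N -> H i.+1 j = 0) ->
     (forall i j, (i < m)%N -> (j.+1 < n)%N -> V i j.+1 = 0) ->
     trivial_deformation m n xi).
Proof.
move=> net def; have [isom _] := def.
(* Off the grid [r] takes the dummy value 0, which makes the choice total; [H] and [V] are treated
   alike below. *)
have /choice[r rP] (f : nat * nat) : exists s, is_face m n f.1 f.2 ->
    exists c, forall x, xi f.1 f.2 x = cross s x + c.
  case: f => i j /=.
  have [F|] := boolP (is_face m n i j); last by exists 0.
  by have [s [c xiE]] := isom i j F; exists s => _; exists c.
have agreeH i j : (i.+1 < m)%N -> (j < n)%N ->
    xi i.+1 j.+1 (p i.+1 j) = xi i.+2 j.+1 (p i.+1 j) /\
    xi i.+1 j.+1 (p i.+1 j.+1) = xi i.+2 j.+1 (p i.+1 j.+1).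
  move=> im jn; have [_ bot _ _] := face_edge_sides i j.
  have [top _ _ _] := face_edge_sides i.+1 j.
  by apply: (deformation_agree _ _ _ _ _ _ _ _ _ _ _ def _ _ bot top);
    rewrite /is_face /= ?jn ?im ?(ltnW im).
have agreeV i j : (i < m)%N -> (j.+1 < n)%N ->
    xi i.+1 j.+2 (p i j.+1) = xi i.+1 j.+1 (p i j.+1) /\
    xi i.+1 j.+2 (p i.+1 j.+1) = xi i.+1 j.+1 (p i.+1 j.+1).
  move=> im jn; have [_ _ left _] := face_edge_sides i j.+1.
  have [_ _ _ right] := face_edge_sides i j.
  by apply: (deformation_agree _ _ _ _ _ _ _ _ _ _ _ def _ _ left right);
    rewrite /is_face /= ?jn ?im ?(ltnW jn).
have /choice[H HP] (e : nat * nat) : exists w : R,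
    (e.1.+1 < m)%N -> (e.2 < n)%N ->
    r (e.1.+2, e.2.+1) - r (e.1.+1, e.2.+1) =
      w *: (p e.1.+1 e.2.+1 - p e.1.+1 e.2).
  case: e => i j /=.
  have [im|] := boolP (i.+1 < m)%N; last by exists 0.
  have [jn|] := boolP (j < n)%N; last by exists 0.
  have F : is_face m n i.+1 j.+1 by rewrite /is_face /= jn (ltnW im).
  have F' : is_face m n i.+2 j.+1 by rewrite /is_face /= jn im.
  have [[c xiE] [c' xi'E]] := (rP (_, _) F, rP (_, _) F').
  have [_ _ e0 _] := planar_quad_sides _ _ _ _ _ (net _ _ F).
  rewrite -oppr_eq0 opprB in e0; have [ea eb] := agreeH i j im jn.
  by have [w ->] := rotation_jump _ _ _ _ _ _ _ _ _ xiE xi'E e0 ea eb; exists w.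
have /choice[V VP] (e : nat * nat) : exists w : R,
    (e.1 < m)%N -> (e.2.+1 < n)%N ->
    r (e.1.+1, e.2.+1) - r (e.1.+1, e.2.+2) =
      w *: (p e.1.+1 e.2.+1 - p e.1 e.2.+1).
  case: e => i j /=.
  have [im|] := boolP (i < m)%N; last by exists 0.
  have [jn|] := boolP (j.+1 < n)%N; last by exists 0.
  have F : is_face m n i.+1 j.+1 by rewrite /is_face /= im (ltnW jn).
  have F' : is_face m n i.+1 j.+2 by rewrite /is_face /= jn im.
  have [[c xiE] [c' xi'E]] := (rP (_, _) F, rP (_, _) F').
  have [_ e0 _ _] := planar_quad_sides _ _ _ _ _ (net _ _ F).
  have [ea eb] := agreeV i j im jn.
  by have [w ->] := rotation_jump _ _ _ _ _ _ _ _ _ xi'E xiE e0 ea eb; exists w.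
(* The chosen functions index an edge by the faces beside it; the predecessors pass to indexing by
   its first vertex. *)
exists (fun i j => H (i.-1, j)), (fun i j => V (i, j.-1)); split=> [i j im jn|].
  (* Turned back into jumps of [r], the four terms telescope around the vertex. *)
  rewrite /= -(HP (i, j.+1)) // -(VP (i.+1, j)) //=.
  rewrite -[p i.+1 j - _]opprB -[p i j.+1 - _]opprB !scalerN.
  rewrite -(HP (i, j)) ?(ltnW jn) // -(VP (i, j)) ?(ltnW im) //=.
  by apply/row3P; rewrite !mxE; split; ring.
move=> H0 V0.
have stepH i j : (i.+1 < m)%N -> (j < n)%N -> xi i.+1 j.+1 =1 xi i.+2 j.+1.
  move=> im jn.
  have F : is_face m n i.+1 j.+1 by rewrite /is_face /= jn (ltnW im).
  have F' : is_face m n i.+2 j.+1 by rewrite /is_face /= jn im.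
  have [[c xiE] [c' xi'E]] := (rP (_, _) F, rP (_, _) F').
  have := HP (i, j) im jn; rewrite (H0 i j) // scale0r => /subr0_eq /= e.
  rewrite /= e in xi'E.
  exact: isometry_eq_of_rotation xiE xi'E (proj1 (agreeH i j im jn)).
have stepV i j : (i < m)%N -> (j.+1 < n)%N -> xi i.+1 j.+1 =1 xi i.+1 j.+2.
  move=> im jn.
  have F : is_face m n i.+1 j.+1 by rewrite /is_face /= im (ltnW jn).
  have F' : is_face m n i.+1 j.+2 by rewrite /is_face /= jn im.
  have [[c xiE] [c' xi'E]] := (rP (_, _) F, rP (_, _) F').
  have := VP (i, j) im jn; rewrite (V0 i j) // scale0r => /subr0_eq /= e.
  rewrite /= e in xiE.
  exact: isometry_eq_of_rotation xiE xi'E (esym (proj1 (agreeV i j im jn))).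
(* Go up the column to the first row, then along that row. *)
have all11 i j : (i < m)%N -> (j < n)%N -> xi i.+1 j.+1 =1 xi 1%N 1%N.
  elim: i => [|i IHi] im jn x; last by rewrite -stepH // IHi // ltnW.
  by elim: j jn => [//|j IHj] jn; rewrite -stepV // IHj // ltnW.
move=> [|i] [|j] [|i'] [|j']; rewrite /is_face ?andbF //=.
by move=> /andP[im jn] /andP[im' jn'] x; rewrite !all11.
Qed.

Theorem theorem14 (R : realType) (p : nat -> nat -> 'rV[R]_3)
  (hnet : conjugate_net 3 4 p)
  (h11 : p 1%N 1%N = vec3 0 0 0)
  (h12 : p 1%N 2%N = vec3 0 0 (-1))
  (h13 : p 1%N 3%N = vec3 0 1 (-1))
  (h21 : p 2%N 1%N = vec3 1 0 0)
  (h22 : p 2%N 2%N = vec3 1 0 (-1))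
  (h23 : p 2%N 3%N = vec3 1 1 (-1))
  (h10 : p 1%N 0%N = p 1%N 1%N - vec3 1 1 (-1))
  (h20 : p 2%N 0%N = p 2%N 1%N - vec3 1 1 (-1))
  (h14 : p 1%N 4%N = p 1%N 3%N + vec3 (-1) 1 (-1))
  (h24 : p 2%N 4%N = p 2%N 3%N + vec3 1 1 (-1))
  (h0 : forall j : nat, (1 <= j <= 3)%N ->
          p 0%N j = p 1%N j - vec3 0 (-1) (-1))
  (h3 : forall j : nat, (1 <= j <= 3)%N ->
          p 3%N j = p 2%N j + vec3 0 1 1)
  (hc11 : on_face (@strictly_convex_planar_quad R) p 1 1)
  (hc14 : on_face (@strictly_convex_planar_quad R) p 1 4)
  (hc31 : on_face (@strictly_convex_planar_quad R) p 3 1)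
  (hc34 : on_face (@strictly_convex_planar_quad R) p 3 4) :
  [/\ infinitesimally_flexible 3 3 (subnet 0 0 p),
      infinitesimally_flexible 3 3 (subnet 0 1 p)
    & infinitesimally_rigid 3 4 p].
Proof.
have pE := (h10, h20, h14, h24, h0 1%N isT, h0 2%N isT, h0 3%N isT,
            h3 1%N isT, h3 2%N isT, h3 3%N isT, h11, h12, h13, h21, h22, h23).
split.
(* With [V 1 1 = 1], the multiples of [deformation_stress] are 1, 2, 2 for [H 1 j] and -1, -2, -2
   for [H 2 j], j = 0, 1, 2. Adding the jumps outwards from the central face gives [r]. The empty
   row and leading zeros are padding, as faces are indexed from 1. *)
- pose r i j := nth 0 (nth [::]
    [:: [::]; [:: 0; vec3 0 (-1) 1; vec3 0 0 2; vec3 0 (-2) 0];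
        [:: 0; vec3 1 0 0; 0; 0];
        [:: 0; vec3 0 (-1) 1; vec3 0 0 2; vec3 0 (-2) 0]] i) j : 'rV[R]_3.
  apply: (flexible_3x3 _ _ r) => //.
    by apply/eqP => /row3P; rewrite !(vec3E, mxE) => -[]; lra.
  (* A corner vertex lies on one face only, which is its own reference, so its unknown position does
     not matter. *)
  move=> [|[|[|[|i]]]] [|[|[|[|j]]]] // v _;
    rewrite /face_verts !inE /= => /or4P[] /eqP-> //=;
    rewrite /subnet ?(add0n, add1n) !pE; apply/row3P;
    by rewrite /cross !(vec3E, mxE); split; ring.
(* In the indices of the whole net, both [H 1 j] and [H 2 j] are now 2, 2, 1 for j = 1, 2, 3: equal
   signs, where the first subnet has opposite ones. *)
- pose r i j := nth 0 (nth [::]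
    [:: [::]; [:: 0; vec3 0 0 2; vec3 0 (-2) 0; vec3 0 (-1) 1];
        [:: 0; 0; 0; vec3 (-1) 0 0];
        [:: 0; vec3 0 0 (-2); vec3 0 2 0; vec3 0 1 (-1)]] i) j : 'rV[R]_3.
  apply: (flexible_3x3 _ _ r) => //.
    by apply/eqP => /row3P; rewrite !(vec3E, mxE) => -[]; lra.
  move=> [|[|[|[|i]]]] [|[|[|[|j]]]] // v _;
    rewrite /face_verts !inE /= => /or4P[] /eqP-> //=;
    rewrite /subnet ?(add0n, add1n) !pE; apply/row3P;
    by rewrite /cross !(vec3E, mxE); split; ring.
move=> [xi [def]]; apply.
have [H [V [bal triv]]] := deformation_stress _ _ _ _ _ hnet def.
have := (bal 0%N 0%N isT isT, bal 0%N 1%N isT isT, bal 0%N 2%N isT isT,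
         bal 1%N 0%N isT isT, bal 1%N 1%N isT isT, bal 1%N 2%N isT isT).
rewrite !pE => -[[[[[]]]]].
do 6![move=> /row3P; rewrite !(vec3E, mxE) => -[? ? ?]].
(* The left vertices give [H 1 1 = 2 * V 1 1] and [H 2 1 = - 2 * V 1 1], the middle ones
   [H i 2 = H i 1] and [V 1 2 = 0], the right ones [H 1 2 = 2 * V 1 3 = H 2 2]. Hence
   [V 1 1 = - V 1 1], and everything vanishes. *)
apply: triv => [[|[|//]] [|[|[|[|//]]]] _ _|[|[|[|//]]] [|[|[|//]]] _ _]; lra.
Qed.
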